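(* Let $(X,\varrho)$ be a complete metric space and let $t_\star>0$. If $U$ is a $t_\star$-closed, asymptotically compact and monotonically dissipative strict m-process on $X$, then the pullback attractor $\mathbb A=\{A(t):t\in\mathbb R\}$ of $U$ is invariant, namely $$A(t)=U(t,s;A(s))\qquad\text{for all } s\le t,\ s,t\in\mathbb R.$$
   Context: $P(X)$ is the family of nonempty subsets of $X$, $\mathcal B(X)$ the family of nonempty bounded subsets of $X$, $\mathbb R_d=\{(s,t)\in\mathbb R^2: s\ge t\}$. For a point $y$ and sets $A,B\subset X$: $\mathrm{dist}(y,B)=\inf_{x\in B}\varrho(x,y)$ and $\mathrm{dist}(A,B)=\sup_{y\in A}\mathrm{dist}(y,B)$, with $\inf\emptyset=+\infty$. A strict m-process on $X$ is a map $U:\mathbb R_d\times X\to P(X)$, $(t,\tau,x)\mapsto U(t,\tau;x)$, such that (i) $U(t,t;x)=\{x\}$ for all $t\in\mathbb R$, $x\in X$; (ii) $U(t,\tau;x)=U(t,s;U(s,\tau;x))$ for all $t\ge s\ge\tau$, $x\in X$, where $U(t,s;A)=\bigcup_{y\in A}U(t,s;y)$. For $t_\star>0$, $U$ is $t_\star$-closed if for every $t\in\mathbb R$ the map $U(t,t-t_\star;\cdot)$ has closed graph: $\eta_n\to\eta$, $\xi_n\in U(t,t-t_\star;\eta_n)$ and $\xi_n\to\xi$ imply $\xi\in U(t,t-t_\star;\eta)$. A nonautonomous set is a family $\{K(t)\subset X:t\in\mathbb R\}$; it is closed (compact, bounded) if every $K(t)$ is. It is pullback attracting for $U$ if $\lim_{\tau\to-\infty}\mathrm{dist}(U(t,\tau;B),K(t))=0$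 for every $t\in\mathbb R$ and $B\in\mathcal B(X)$. A pullback attractor for $U$ is a nonautonomous set that is compact, pullback attracting, and minimal in the class of closed pullback attracting nonautonomous sets (i.e. $A(t)\subset C(t)$ for all $t$ for every closed pullback attracting $\{C(t)\}$). An asymptotically compact, monotonically dissipative m-process has a unique pullback attractor. $U$ is (pullback) asymptotically compact if for every $B\in\mathcal B(X)$, $t\in\mathbb R$ and any sequences $\tau_n\to-\infty$, $\xi_n\in U(t,\tau_n;B)$, the sequence $(\xi_n)$ has a subsequence converging in $X$. $U$ is monotonically dissipative if there is a bounded nonautonomous set $\{B_0(t):t\in\mathbb R\}$ with $B_0(s)\subset B_0(t)$ for every $s\le t$, such that for every $E\in\mathcal B(X)$ and $t\in\mathbb R$ there is $\bar\tau=\bar\tau(t,E)\le t$ with $U(t,\tau;E)\subset B_0(t)$ for all $\tau\le\bar\tau$. *)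

(* Defs.v *)
From HB Require Import structures.
From mathcomp Require Import all_boot all_order all_algebra.
From mathcomp Require Import all_classical all_reals all_analysis.

Set Implicit Arguments.
Unset Strict Implicit.
Unset Printing Implicit Defensive.

Import Order.TTheory GRing.Theory Num.Theory.
Import numFieldNormedType.Exports.

Local Open Scope classical_set_scope.
Local Open Scope ring_scope.

(* The library's [completeType] additionally asks for a distinguished point;
   this is its defining property without that requirement. *)
Definition complete_space (X : uniformType) : Prop :=
  forall F : set_system X, ProperFilter F -> cauchy F -> exists l : X, F --> l.

Definition bounded_subset (R : realType) (X : metricType R) (B : set X) : Prop :=
  exists M : R, forall x y, B x -> B y -> mdist x y <= M.

(* In [\bar R], so that the infimum over the empty set is +oo. *)
Definition dist_pt (R : realType) (X : metricType R) (y : X) (B : set X)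
    : \bar R :=
  ereal_inf [set (mdist x y)%:E | x in B].

(* The one-sided (non-symmetric) Hausdorff semidistance. *)
Definition dist_set (R : realType) (X : metricType R) (A B : set X) : \bar R :=
  ereal_sup [set dist_pt y B | y in A].

(* Carrier of m-processes: [U t tau x] stands for U(t,tau;x). It is total in
   (t, tau), but every condition below constrains or uses it only for
   tau <= t, so the values outside that half-plane are irrelevant. *)
Definition two_time_map (R : realType) (X : metricType R) : Type :=
  R -> R -> X -> set X.

Definition image_at (R : realType) (X : metricType R)
    (U : two_time_map X) (t tau : R) (A : set X) : set X :=
  \bigcup_(y in A) U t tau y.

Record strict_m_process (R : realType) (X : metricType R)
    (U : two_time_map X) : Prop := StrictMProcess {
  mproc_nonempty : forall t tau x, tau <= t -> U t tau x !=set0 ;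
  mproc_id : forall t x, U t t x = [set x] ;
  mproc_comp : forall t s tau x, tau <= s -> s <= t ->
    U t tau x = image_at U t s (U s tau x) }.

Definition tstar_closed (R : realType) (X : metricType R)
    (tstar : R) (U : two_time_map X) : Prop :=
  forall (t : R) (eta_ xi_ : nat -> X) (eta xi : X),
    eta_ @ \oo --> eta ->
    (forall n, U t (t - tstar) (eta_ n) (xi_ n)) ->
    xi_ @ \oo --> xi ->
    U t (t - tstar) eta xi.

Definition nonautonomous_set (R : realType) (X : metricType R) : Type :=
  R -> set X.

(* The limit is taken in [\bar R]: the semidistance may be infinite. *)
Definition pullback_attracting (R : realType) (X : metricType R)
    (U : two_time_map X) (K : nonautonomous_set X) : Prop :=
  forall (t : R) (B : set X), B !=set0 -> bounded_subset B ->
    dist_set (image_at U t tau B) (K t) @[tau --> -oo%R] --> 0%E.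

Definition pullback_attractor (R : realType) (X : metricType R)
    (U : two_time_map X) (A : nonautonomous_set X) : Prop :=
  [/\ forall t, compact (A t),
      pullback_attracting U A
    & forall C : nonautonomous_set X,
        (forall t, closed (C t)) -> pullback_attracting U C ->
        forall t, A t `<=` C t].

Definition asymptotically_compact (R : realType) (X : metricType R)
    (U : two_time_map X) : Prop :=
  forall (B : set X) (t : R), B !=set0 -> bounded_subset B ->
  forall (tau_ : nat -> R) (xi_ : nat -> X),
    tau_ @ \oo --> -oo%R ->
    (forall n, tau_ n <= t) ->
    (forall n, image_at U t (tau_ n) B (xi_ n)) ->
    exists phi : nat -> nat, exists xi : X,
      {homo phi : m n / (m < n)%N} /\ (xi_ \o phi) @ \oo --> xi.

Definition monotonically_dissipative (R : realType) (X : metricType R)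
    (U : two_time_map X) : Prop :=
  exists B0 : nonautonomous_set X,
    [/\ forall t, bounded_subset (B0 t),
        forall s t, s <= t -> B0 s `<=` B0 t
      & forall (E : set X) (t : R), E !=set0 -> bounded_subset E ->
          exists2 taubar : R, taubar <= t &
            forall tau, tau <= taubar -> image_at U t tau E `<=` B0 t].

Definition invariant_under (R : realType) (X : metricType R)
    (U : two_time_map X) (A : nonautonomous_set X) : Prop :=
  forall s t : R, s <= t -> A t = image_at U t s (A s).

(* Main.v *)
Require Import Defs.
From mathcomp Require Import all_boot all_order all_algebra.
From mathcomp Require Import all_classical all_reals all_analysis.
From mathcomp Require Import lra.

Set Implicit Arguments.
Unset Strict Implicit.
Unset Printing Implicit Defensive.

Import Order.TTheory GRing.Theory Num.Theory.

Local Open Scope classical_set_scope.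
Local Open Scope ring_scope.

(** Why the attractor is invariant. The closed graph is available only for
    steps of length [tstar], and it gives the negative invariance of [A] over
    such a step: a point of an omega-limit set at time [t] is a limit of
    values at [t] whose trajectories, by asymptotic compactness, accumulate at
    time [t - tstar] at a point of the omega-limit set there, and the closed
    graph passes to the limit ([omega_limit_preimage]). To apply this to
    [A t], one needs a single bounded set whose omega-limit set contains it;
    monotone dissipativity provides the absorbing set [B0 t] itself
    ([omega_limit_absorbing]), since the sets [omega_limit U (B0 t) t] are then
    closed and attracting, and [A] is minimal
    ([attractor_sub_omega_limit]). Conversely, omega-limit sets of bounded
    sets lie in every closed attracting family
    ([omega_limit_sub_attracting]), so the preimages found belong to
    [A (t - tstar)].

    Positive invariance, over steps of arbitrary length, follows from negative
    invariance over [tstar]-steps ([positively_invariant]). Monotone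
    dissipativity confines all [A q], [q <= r], to one bounded set [D]. Since
    [A r] is contained in [U (r, r - k tstar; D)] for every [k], the set
    [U (s, r; A r)] is contained in [U (s, r - k tstar; D)] for every [k], and
    these sets approach the closed set [A s].

    Finally, negative invariance over an arbitrary step from [s] to [t] is
    obtained by overshooting: go back from [t] by enough [tstar]-steps to be
    before [s], then return to [s] by positive invariance. *)

(** * Metric and order preliminaries *)

Lemma closure_mdistP (R : realType) (X : metricType R) (B : set X) (x : X) :
  closure B x <-> forall e : R, 0 < e -> exists2 y, B y & mdist x y < e.
Proof.
split=> [clBx e e0|Bx V].
  have [y [By]] := clBx _ (nbhsx_ballx x e e0).
  by rewrite ballEmdist => /= xy; exists y.
rewrite -metricType_numDomainType.filter_from_mdist_nbhs => -[e /= e0 eV].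
by have [y By xy] := Bx e e0; exists y; split => //; exact: eV.
Qed.

Lemma bounded_closure (R : realType) (X : metricType R) (B : set X) :
  bounded_subset B -> bounded_subset (closure B).
Proof.
move=> [M BM]; exists M => x y /closure_mdistP clx /closure_mdistP cly.
apply/ler_addgt0Pl => e e0; have e20 : 0 < e / 2 by lra.
have [x' Bx' xx'] := clx _ e20; have [y' By' yy'] := cly _ e20.
have := metric_triangle x x' y; have := metric_triangle x' y' y.
have := BM _ _ Bx' By'; rewrite (metric_sym y' y); lra.
Qed.

Lemma cvg_subsequence (phi : nat -> nat) :
  {homo phi : m n / (m < n)%N} -> phi @ \oo --> \oo.
Proof.
move=> phi_incr P [N _ NP]; exists N => // n /= Nn; apply: NP => /=.
apply: leq_trans Nn _; elim: n => // n IHn.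
by apply: leq_ltn_trans IHn _; exact: phi_incr.
Qed.

Lemma cvg_lt_ninfty (R : realType) (tau_ : nat -> R) (t : R) :
  (forall n, tau_ n <= t - n%:R) -> tau_ @ \oo --> -oo.
Proof.
move=> tauP; apply/cvgrNyPle => M.
have /cvgryPge/(_ (t - M)) := @cvgr_idn R.
apply: filterS => n; have := tauP n; lra.
Qed.

Lemma steps_back_le (R : realType) (t s h : R) :
  0 < h -> exists k : nat, t - k%:R * h <= s.
Proof.
move=> h0; exists (Num.truncn ((t - s) / h)).+1.
have := truncnS_gt ((t - s) / h); rewrite ltr_pdivrMr//; lra.
Qed.

(** * Images and pullback attraction *)

Lemma image_atS (R : realType) (X : metricType R) (U : two_time_map X)
    (t s : R) (B C : set X) :
  B `<=` C -> image_at U t s B `<=` image_at U t s C.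
Proof. by move=> BC x [y /BC Cy Ux]; exists y. Qed.

Lemma image_at_comp (R : realType) (X : metricType R) (U : two_time_map X)
    (t s tau : R) (B : set X) :
  strict_m_process U -> tau <= s -> s <= t ->
  image_at U t tau B = image_at U t s (image_at U s tau B).
Proof.
move=> UP taus st; apply/seteqP; split=> x.
  move=> [b Bb]; rewrite (mproc_comp UP _ taus st) => -[y Uy Ux].
  by exists y => //; exists b.
move=> [y [b Bb Uy] Ux]; exists b => //.
by rewrite (mproc_comp UP _ taus st); exists y.
Qed.

Lemma image_at_nonempty (R : realType) (X : metricType R) (U : two_time_map X)
    (t tau : R) (B : set X) :
  strict_m_process U -> tau <= t -> B !=set0 -> image_at U t tau B !=set0.
Proof.
move=> UP taut [b Bb]; have [x Ux] := mproc_nonempty UP b taut.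
by exists x; exists b.
Qed.

(** The semidistance is extended real, and a supremum over nothing would be
    minus infinity; nonemptiness of the values of [U] bounds it below by 0,
    after which convergence to 0 is this condition on points. *)
Lemma pullback_attractingP (R : realType) (X : metricType R)
    (U : two_time_map X) (K : nonautonomous_set X) :
  strict_m_process U ->
  pullback_attracting U K <->
  forall (t : R) (B : set X), B !=set0 -> bounded_subset B ->
    forall e : R, 0 < e -> exists s : R, forall tau, tau <= s ->
      forall x, image_at U t tau B x -> exists2 y, K t y & mdist y x < e.
Proof.
move=> UP; split=> [KP t B B0 bB e e0|KP t B B0 bB].
  have near_lt : nbhs (0%E : \bar R) [set y | (y < e%:E)%E].
    by apply: (@nbhs_open_ereal_lt _ 0 (fun=> e)).
  have [M [_ MP]] := KP t B B0 bB _ near_lt.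
  exists (M - 1) => tau tauM x Ux.
  have /= dlt : (dist_set (image_at U t tau B) (K t) < e%:E)%E.
    by apply: MP; lra.
  have : (dist_pt x (K t) < e%:E)%E.
    by apply: le_lt_trans dlt; apply: ereal_sup_ubound; exists x.
  by move=> /ereal_inf_lt[_ [y Ky <-]]; rewrite lte_fin => yx; exists y.
have dP e : 0 < e -> \forall tau \near -oo,
    (0 <= dist_set (image_at U t tau B) (K t) <= e%:E)%E.
  move=> e0; have [s sP] := KP t B B0 bB e e0.
  exists (Num.min s t); split; first exact: num_real.
  move=> tau; rewrite lt_min => /andP[/ltW taus /ltW taut].
  apply/andP; split.
    have [x Ux] := image_at_nonempty UP taut B0.
    apply: le_ereal_sup_tmp; exists (dist_pt x (K t)); first by exists x.
    by apply: le_ereal_inf_tmp => _ [y _ <-]; rewrite lee_fin mdist_ge0.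
  apply: ge_ereal_sup => _ [x Ux <-].
  have [y Ky yx] := sP _ taus x Ux.
  apply: ge_ereal_inf; exists (mdist y x)%:E; first by exists y.
  by rewrite lee_fin ltW.
apply/fine_cvgP; split.
  apply: filterS (dP 1 ltr01) => tau /andP[d0 d1].
  by rewrite fin_numE; case: (dist_set _ _) d0 d1.
apply/cvgrPdist_le => e e0; apply: filterS (dP e e0) => tau /=.
case: (dist_set _ _) => [r| |] /andP[d0 de] //=.
  by rewrite sub0r normrN ger0_norm.
Qed.

(** * Omega-limit sets *)

Definition history (R : realType) (X : metricType R) (U : two_time_map X)
    (t s : R) (B : set X) : set X :=
  \bigcup_(tau in [set tau | tau <= s]) image_at U t tau B.

Definition omega_limit (R : realType) (X : metricType R) (U : two_time_map X)
    (B : set X) (t : R) : set X :=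
  \bigcap_(s in [set s | s <= t]) closure (history U t s B).

Lemma closed_omega_limit (R : realType) (X : metricType R)
    (U : two_time_map X) (B : set X) (t : R) : closed (omega_limit U B t).
Proof. by apply: closed_bigI => s _; exact: closed_closure. Qed.

(** The starting times can be taken below any prescribed [s], so that the
    trajectories producing [x] all pass through time [s]. *)
Lemma omega_limit_seq (R : realType) (X : metricType R) (U : two_time_map X)
    (B : set X) (t s : R) (x : X) :
  s <= t -> omega_limit U B t x ->
  exists tau_ : nat -> R, exists xi_ : nat -> X,
    [/\ tau_ @ \oo --> -oo, forall n, tau_ n <= s,
        forall n, image_at U t (tau_ n) B (xi_ n) & xi_ @ \oo --> x].
Proof.
move=> st ox.
have /choice[f fP] n : exists p : R * X,
    [/\ p.1 <= s - n%:R, image_at U t p.1 B p.2 & mdist x p.2 < n.+1%:R^-1].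
  have sn : s - n%:R <= t by rewrite lerBlDr (le_trans st)// lerDl.
  have /closure_mdistP/(_ n.+1%:R^-1) := ox _ sn.
  rewrite invr_gt0 ltr0Sn => /(_ isT)[y [tau taus Uy] xy].
  by exists (tau, y).
exists (fst \o f), (snd \o f); split => [|n|n|] /=.
- by apply: (@cvg_lt_ninfty _ _ s) => n; have [] := fP n.
- have [+ _ _] := fP n => /le_trans; apply; rewrite gerBl//.
- by have [] := fP n.
- apply/metricType_numDomainType.cvgrPdist_lt => e e0.
  apply: filterS (near_infty_natSinv_lt (PosNum e0)) => n /= ne.
  by have [_ _ /lt_trans] := fP n; apply.
Qed.

(** Asymptotic compactness only provides a limit; the limit lies in the
    omega-limit set because the starting times of the subsequence still go
    to minus infinity. *)
Lemma asymptotically_compact_omega (R : realType) (X : metricType R)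
    (U : two_time_map X) (B : set X) (t : R)
    (tau_ : nat -> R) (xi_ : nat -> X) :
  asymptotically_compact U -> B !=set0 -> bounded_subset B ->
  tau_ @ \oo --> -oo -> (forall n, tau_ n <= t) ->
  (forall n, image_at U t (tau_ n) B (xi_ n)) ->
  exists phi : nat -> nat, exists xi : X,
    [/\ {homo phi : m n / (m < n)%N}, (xi_ \o phi) @ \oo --> xi
      & omega_limit U B t xi].
Proof.
move=> aU B0 bB tauNy taut Uxi.
have [phi [xi [phiP xiP]]] := aU B t B0 bB tau_ xi_ tauNy taut Uxi.
exists phi, xi; split => // s _; apply/closure_mdistP => e e0.
have /cvgrNyPle/(_ s) taus : (tau_ \o phi) @ \oo --> -oo.
  exact: cvg_comp (cvg_subsequence phiP) tauNy.
have xie : \forall n \near \oo, mdist xi (xi_ (phi n)) < e.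
  exact: (@metricType_numDomainType.cvgr_dist_lt _ _ _ _ _ _ _ xiP _ e0).
have [n [/= tn xn]] := filter_ex (filterI taus xie).
by exists (xi_ (phi n)) => //; exists (tau_ (phi n)).
Qed.

(** If [K t] failed to attract [B], values at time [t] issued from [B] ever
    earlier would stay away from [K t]; by asymptotic compactness they would
    accumulate at a point of the omega-limit set, which [K t] contains. *)
Lemma omega_limit_attracting (R : realType) (X : metricType R)
    (U : two_time_map X) (K : nonautonomous_set X) :
  strict_m_process U -> asymptotically_compact U ->
  (forall t B, B !=set0 -> bounded_subset B -> omega_limit U B t `<=` K t) ->
  pullback_attracting U K.
Proof.
move=> UP aU oK; apply/pullback_attractingP => // t B B0 bB e e0.
apply: contrapT => /forallNP far.
have /choice[f fP] (n : nat) : exists p : R * X, [/\ p.1 <= t - n%:R,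
    image_at U t p.1 B p.2 & forall y, K t y -> e <= mdist y p.2].
  have /existsNP[tau /not_implyP[taun /existsNP[x /not_implyP[Ux /forall2NP Kx]]]] :=
    far (t - n%:R).
  by exists (tau, x); split => // y Ky; rewrite leNgt; apply/negP; case: (Kx y).
have tauNy : (fst \o f) @ \oo --> -oo.
  by apply: (@cvg_lt_ninfty _ _ t) => n; have [] := fP n.
have taut n : (fst \o f) n <= t.
  by have [+ _ _] := fP n => /le_trans; apply; rewrite gerBl.
have Uxi n : image_at U t ((fst \o f) n) B ((snd \o f) n) by have [] := fP n.
have [phi [xi [phiP xiP oxi]]] :=
  asymptotically_compact_omega aU B0 bB tauNy taut Uxi.
have xie : \forall n \near \oo, mdist xi ((snd \o f) (phi n)) < e.
  exact: (@metricType_numDomainType.cvgr_dist_lt _ _ _ _ _ _ _ xiP _ e0).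
have [n /=] := filter_ex xie; have [_ _ /(_ _ (oK _ _ B0 bB _ oxi))] := fP (phi n).
by rewrite leNgt => /negP.
Qed.

(** Values close to a point of the omega-limit set are themselves close to
    [C t], so the point is in the closure of [C t]. *)
Lemma omega_limit_sub_attracting (R : realType) (X : metricType R)
    (U : two_time_map X) (C : nonautonomous_set X) (B : set X) (t : R) :
  strict_m_process U -> (forall t, closed (C t)) -> pullback_attracting U C ->
  B !=set0 -> bounded_subset B -> omega_limit U B t `<=` C t.
Proof.
move=> UP clC /(pullback_attractingP _ UP) aC B0 bB x ox; apply: clC.
apply/closure_mdistP => e e0; have e20 : 0 < e / 2 by lra.
have [s sP] := aC t B B0 bB _ e20.
have st : Num.min s t <= t by rewrite ge_min lexx orbT.
have /closure_mdistP/(_ _ e20)[y [tau]] := ox _ st.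
rewrite /= le_min => /andP[taus _] Uy xy.
have [z Cz zy] := sP _ taus y Uy; exists z => //.
have := metric_triangle x y z; rewrite (metric_sym y z); lra.
Qed.

(** * The pullback attractor *)

Definition pullback_absorbing (R : realType) (X : metricType R)
    (U : two_time_map X) (B0 : nonautonomous_set X) : Prop :=
  forall (E : set X) (t : R), E !=set0 -> bounded_subset E ->
    exists2 taubar : R, taubar <= t &
      forall tau, tau <= taubar -> image_at U t tau E `<=` B0 t.

(** At every time [s <= t], values starting from [B] early enough pass through
    [B0 s], hence, by monotonicity of the absorbing family, through the single
    bounded set [B0 t]. *)
Lemma omega_limit_absorbing (R : realType) (X : metricType R)
    (U : two_time_map X) (B0 : nonautonomous_set X) (B : set X) (t : R) :
  strict_m_process U ->
  (forall s t, s <= t -> B0 s `<=` B0 t) ->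
  pullback_absorbing U B0 ->
  B !=set0 -> bounded_subset B ->
  omega_limit U B t `<=` omega_limit U (B0 t) t.
Proof.
move=> UP B0S B0P Bn bB x ox s /= st.
have [r rs rP] := B0P B s Bn bB.
have := ox r (le_trans rs st); apply: closureS => y [tau /= taur].
rewrite (image_at_comp _ UP (le_trans taur rs) st) => Uy.
exists s => //=; apply: image_atS Uy.
by apply: subset_trans (rP _ taur) _; exact: B0S.
Qed.

(** The omega-limit sets of the absorbing sets form a closed attracting
    family, so minimality puts the attractor inside them. *)
Lemma attractor_sub_omega_limit (R : realType) (X : metricType R)
    (U : two_time_map X) (A B0 : nonautonomous_set X) (t : R) :
  strict_m_process U -> asymptotically_compact U -> pullback_attractor U A ->
  (forall s t, s <= t -> B0 s `<=` B0 t) ->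
  pullback_absorbing U B0 ->
  A t `<=` omega_limit U (B0 t) t.
Proof.
move=> UP aU [_ _ Amin] B0S B0P.
apply: (Amin (fun t => omega_limit U (B0 t) t)) => [r|].
  exact: closed_omega_limit.
apply: omega_limit_attracting => // r B Bn bB.
exact: omega_limit_absorbing.
Qed.

(** Together with the monotonicity of the absorbing sets, this makes the union
    of [A s] over all [s <= t] bounded, so that the attractor attracts its
    own past. *)
Lemma attractor_sub_closure (R : realType) (X : metricType R)
    (U : two_time_map X) (A B0 : nonautonomous_set X) (t : R) :
  strict_m_process U -> pullback_attractor U A ->
  pullback_absorbing U B0 ->
  A t `<=` closure (B0 t).
Proof.
move=> UP [_ _ Amin] B0P.
apply: (Amin (fun t => closure (B0 t))) => [r|]; first exact: closed_closure.
apply/pullback_attractingP => // r B Bn bB e e0.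
have [s _ sP] := B0P B r Bn bB; exists s => tau taus x Ux.
by exists x; [apply: subset_closure; exact: sP Ux|rewrite mdistxx].
Qed.

(** Trajectories ending near [x] at time [t] are relatively compact at time
    [t - tstar] as well; the closed graph makes an accumulation point [eta] of
    them there a preimage of [x]. *)
Lemma omega_limit_preimage (R : realType) (X : metricType R) (tstar : R)
    (U : two_time_map X) (B : set X) (t : R) :
  0 < tstar -> strict_m_process U -> tstar_closed tstar U ->
  asymptotically_compact U -> B !=set0 -> bounded_subset B ->
  omega_limit U B t `<=`
    image_at U t (t - tstar) (omega_limit U B (t - tstar)).
Proof.
move=> tstar0 UP clU aU Bn bB x ox.
have tt : t - tstar <= t by lra.
have [tau_ [xi_ [tauNy taut Uxi xix]]] := omega_limit_seq tt ox.
have /choice[eta_ etaP] n : exists y, image_at U (t - tstar) (tau_ n) B y /\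
    U t (t - tstar) y (xi_ n).
  have := Uxi n; rewrite (image_at_comp _ UP (taut n) tt) => -[y Uy yx].
  by exists y.
have [phi [eta [phiP etaeta oeta]]] :=
  asymptotically_compact_omega aU Bn bB tauNy taut (fun n => (etaP n).1).
exists eta => //.
apply: (clU t (eta_ \o phi) (xi_ \o phi)) => // [n|].
  exact: (etaP (phi n)).2.
exact: cvg_comp (cvg_subsequence phiP) xix.
Qed.

Lemma negatively_invariant_iter (R : realType) (X : metricType R) (tstar : R)
    (U : two_time_map X) (A : nonautonomous_set X) (t : R) (k : nat) :
  0 < tstar -> strict_m_process U ->
  (forall t, A t `<=` image_at U t (t - tstar) (A (t - tstar))) ->
  A t `<=` image_at U t (t - k%:R * tstar) (A (t - k%:R * tstar)).
Proof.
move=> tstar0 UP Aneg; elim: k => [|k IHk].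
  rewrite mul0r subr0 => x Ax; exists x => //.
  by rewrite (mproc_id UP).
have kE : t - k.+1%:R * tstar = t - k%:R * tstar - tstar.
  by rewrite -natr1 mulrDl mul1r opprD addrA.
have k0 : 0 <= k%:R * tstar by rewrite mulr_ge0// ltW.
have le1 : t - k%:R * tstar - tstar <= t - k%:R * tstar by lra.
have le2 : t - k%:R * tstar <= t by lra.
rewrite kE (image_at_comp _ UP le1 le2).
by apply: subset_trans IHk _; apply: image_atS; exact: Aneg.
Qed.

(** [A r] is reached from the bounded set [D] at arbitrarily early times, so
    its images are attracted by [A s], which is closed. *)
Lemma positively_invariant (R : realType) (X : metricType R) (tstar : R)
    (U : two_time_map X) (A : nonautonomous_set X) (D : set X) (r s : R) :
  0 < tstar -> strict_m_process U ->
  (forall t, closed (A t)) -> pullback_attracting U A ->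
  (forall t, A t `<=` image_at U t (t - tstar) (A (t - tstar))) ->
  bounded_subset D -> (forall q, q <= r -> A q `<=` D) -> r <= s ->
  image_at U s r (A r) `<=` A s.
Proof.
move=> tstar0 UP clA /(pullback_attractingP _ UP) atA Aneg bD AD rs x Ux.
have Dn : D !=set0 by case: Ux => y /(AD _ (lexx r)) Dy _; exists y.
apply: clA; apply/closure_mdistP => e e0.
have [q qP] := atA s D Dn bD e e0.
have [k kq] := steps_back_le r q tstar0.
have k0 : 0 <= k%:R * tstar by rewrite mulr_ge0// ltW.
have kr : r - k%:R * tstar <= r by lra.
have [|y Ay yx] := qP _ kq x; last by exists y; rewrite 1?metric_sym.
rewrite (image_at_comp _ UP kr rs); apply: image_atS Ux.
apply: subset_trans (negatively_invariant_iter k tstar0 UP Aneg) _.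
by apply: image_atS; exact: AD.
Qed.

Theorem corollary4p4 (R : realType) (X : metricType R) (tstar : R)
    (U : two_time_map X) (A : nonautonomous_set X) :
  complete_space X ->
  0 < tstar ->
  strict_m_process U ->
  tstar_closed tstar U ->
  asymptotically_compact U ->
  monotonically_dissipative U ->
  pullback_attractor U A ->
  invariant_under U A.
Proof.
move=> _ tstar0 UP clU aU [B0 [bB0 B0S B0P]] AP.
have [cA atA _] := AP.
have clA t : closed (A t).
  by apply: compact_closed; [exact: metric_hausdorff|exact: cA].
have Aneg t : A t `<=` image_at U t (t - tstar) (A (t - tstar)).
  move=> x /(attractor_sub_omega_limit UP aU AP B0S B0P) ox.
  have B0n : B0 t !=set0.
    have [tau [xi [_ _ Uxi _]]] := omega_limit_seq (lexx t) ox.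
    by case: (Uxi 0%N) => y ? _; exists y.
  have := omega_limit_preimage tstar0 UP clU aU B0n (bB0 t) ox.
  by apply: image_atS; exact: omega_limit_sub_attracting.
have Apos r s : r <= s -> image_at U s r (A r) `<=` A s.
  move=> rs; apply: (positively_invariant tstar0 UP clA atA Aneg _ _ rs).
    exact: bounded_closure (bB0 r).
  move=> q qr; apply: subset_trans (attractor_sub_closure UP AP B0P) _.
  by apply: closureS; exact: B0S.
move=> s t st; apply/seteqP; split; last exact: Apos.
have [k ks] := steps_back_le t s tstar0.
(* Negative invariance lands before s; positive invariance leads back to s. *)
apply: subset_trans (negatively_invariant_iter k tstar0 UP Aneg) _.
by rewrite (image_at_comp _ UP ks st); apply: image_atS; exact: Apos.
Qed.
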